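(* Let $n,p\ge 1$ be integers and let $f_1,\dots,f_n:\mathbb{R}^p\to\mathbb{R}$ be convex differentiable functions whose gradients are all Lipschitz-continuous with constant $L>0$, i.e. $\|f_i'(x)-f_i'(y)\|\le L\|x-y\|$ for all $x,y\in\mathbb{R}^p$ and all $i$. Let $g=\frac1n\sum_{i=1}^n f_i$ and assume that $g$ has at least one minimizer; let $x^\ast$ be a minimizer of $g$. Let $(x^k)_{k\ge 0}$ be the iterates of the stochastic average gradient (SAG) method (defined in the context) started at $x^0\in\mathbb{R}^p$ with constant step size $\alpha=\frac{1}{16L}$, and let $\bar{x}^k=\frac1k\sum_{i=0}^{k-1}x^i$. Then for all $k\ge 1$, $$\mathbb{E}[g(\bar{x}^k)]-g(x^\ast)\le \frac{32n}{k}\,C_0,$$ where, if the method is initialized with $y_i^0=0$ for all $i$, $$C_0=g(x^0)-g(x^\ast)+\frac{4L}{n}\|x^0-x^\ast\|^2+\frac{\sigma^2}{16L},\qquad \sigma^2=\frac1n\sum_{i=1}^n\|f_i'(x^\ast)\|^2,$$ and, if the method is initialized with $y_i^0=f_i'(x^0)-g'(x^0)$ for all $i$, $$C_0=\frac32\,[g(x^0)-g(x^\ast)]+\frac{4L}{n}\|x^0-x^\ast\|^2 .$$ Further, if $g$ is $\mu$-strongly convex for some $\mu>0$, then, for each of these two initializations with the corresponding $C_0$, for all $k\ge 1$, $$\mathbb{E}[g(x^k)]-g(x^\ast)\le\Big(1-\min\Big\{\frac{\mu}{16L},\frac{1}{8n}\Big\}\Big)^k C_0 .$$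
   Context: Notation: $\|\cdot\|$ is the Euclidean norm on $\mathbb{R}^p$, and $f_i'$, $g'$ denote gradients. SAG method with constant step size $\alpha$: given deterministic $x^0\in\mathbb{R}^p$ and $y_1^0,\dots,y_n^0\in\mathbb{R}^p$, for each $k\ge 1$ an index $i_k$ is drawn uniformly at random from $\{1,\dots,n\}$, independently of the previous draws, and one sets $$y_i^k=\begin{cases} f_i'(x^{k-1}) & \text{if } i=i_k,\\ y_i^{k-1} & \text{otherwise,}\end{cases}\qquad x^k=x^{k-1}-\frac{\alpha}{n}\sum_{i=1}^n y_i^k .$$ Expectations are taken with respect to the random indices $i_1,i_2,\dots$ only; the functions $f_i$ are deterministic and fixed. The function $g$ is $\mu$-strongly convex if $x\mapsto g(x)-\frac{\mu}{2}\|x\|^2$ is convex. *)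

(* Defs.v *)
From HB Require Import structures.
From mathcomp Require Export all_boot all_order all_algebra.
From mathcomp Require Export all_classical all_reals all_analysis.
Export numFieldNormedType.Exports.

Set Implicit Arguments.
Unset Strict Implicit.
Unset Printing Implicit Defensive.

Import Order.TTheory GRing.Theory Num.Theory.

Local Open Scope classical_set_scope.
Local Open Scope ring_scope.

(* The library's norm [`|x|] on ['rV[R]_p] is the sup norm.  It is used below only
   through the (norm-independent) notion of differentiability. *)
Definition enorm (R : realType) (p : nat) (x : 'rV[R]_p) : R :=
  Num.sqrt (\sum_(j < p) x 0 j ^+ 2).

Definition grad (R : realType) (p : nat) (f : 'rV[R]_p -> R) (x : 'rV[R]_p) :
    'rV[R]_p :=
  \row_j 'D_(delta_mx 0 j) f x.

Definition convex (R : realType) (p : nat) (f : 'rV[R]_p -> R) : Prop :=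
  convex_function [set: convex_lmodType 'rV[R]_p] f.

Definition strongly_convex (R : realType) (p : nat) (mu : R)
    (f : 'rV[R]_p -> R) : Prop :=
  convex (fun x => f x - mu / 2 * enorm x ^+ 2).

Definition average (R : realType) (p n : nat) (f : 'I_n -> 'rV[R]_p -> R) :
    'rV[R]_p -> R :=
  fun x => n%:R^-1 * \sum_(i < n) f i x.

(* ['I_n] carries the discrete sigma-algebra. *)
Definition uniform_iid (d : measure_display) (T : measurableType d)
    (R : realType) (P : probability T R) (n : nat) (idx : nat -> T -> 'I_n) :
    Prop :=
  [/\ forall k (A : set 'I_n), measurable (idx k @^-1` A),
      forall k (i : 'I_n), P (idx k @^-1` [set i]) = (n%:R^-1)%:E &
      forall (J : seq nat) (A : nat -> set 'I_n), uniq J ->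
        P (\bigcap_(k in [set` J]) (idx k @^-1` A k)) =
        (\prod_(k <- J) P (idx k @^-1` A k))%E].

(* The state after [k] steps is the pair of the iterate x^k and the table
   (y_i^k)_i.  The draws are numbered from 0: [s k] is the index i_(k+1), which
   is used by step k+1.  The update of x uses the already updated table. *)
Fixpoint sag_state (R : realType) (p n : nat) (f : 'I_n -> 'rV[R]_p -> R)
    (alpha : R) (x0 : 'rV[R]_p) (y0 : 'I_n -> 'rV[R]_p) (s : nat -> 'I_n)
    (k : nat) : 'rV[R]_p * ('I_n -> 'rV[R]_p) :=
  if k is k'.+1 then
    let: (x, y) := sag_state f alpha x0 y0 s k' in
    let y' := fun i => if i == s k' then grad (f i) x else y i in
    (x - (alpha / n%:R) *: \sum_(i < n) y' i, y')
  else (x0, y0).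

Definition sag (R : realType) (p n : nat) (f : 'I_n -> 'rV[R]_p -> R)
    (alpha : R) (x0 : 'rV[R]_p) (y0 : 'I_n -> 'rV[R]_p) (s : nat -> 'I_n)
    (k : nat) : 'rV[R]_p :=
  (sag_state f alpha x0 y0 s k).1.

Definition sag_mean (R : realType) (p n : nat) (f : 'I_n -> 'rV[R]_p -> R)
    (alpha : R) (x0 : 'rV[R]_p) (y0 : 'I_n -> 'rV[R]_p) (s : nat -> 'I_n)
    (k : nat) : 'rV[R]_p :=
  k%:R^-1 *: \sum_(i < k) sag f alpha x0 y0 s i.

Definition C0_zero (R : realType) (p n : nat) (f : 'I_n -> 'rV[R]_p -> R)
    (L : R) (x0 xstar : 'rV[R]_p) : R :=
  let g := average f in
  let sigma2 := n%:R^-1 * \sum_(i < n) enorm (grad (f i) xstar) ^+ 2 in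
  g x0 - g xstar + 4 * L / n%:R * enorm (x0 - xstar) ^+ 2 + sigma2 / (16 * L).

Definition C0_centered (R : realType) (p n : nat) (f : 'I_n -> 'rV[R]_p -> R)
    (L : R) (x0 xstar : 'rV[R]_p) : R :=
  let g := average f in
  3 / 2 * (g x0 - g xstar) + 4 * L / n%:R * enorm (x0 - xstar) ^+ 2.

(* Main.v *)
Require Import Defs.
From mathcomp Require Import ring lra.

Set Implicit Arguments.
Unset Strict Implicit.
Unset Printing Implicit Defensive.

Import Order.TTheory GRing.Theory Num.Theory.

Local Open Scope classical_set_scope.
Local Open Scope ring_scope.

(** Write [d = 1 / (16 n L)], [s] for the sum of the table entries [y_i], and
    [u_i = y_i - f_i'(x_star)].  Both rates come from one potential,
    [g (x + d s) - g x_star + a1 |s|^2 + a2 sum_i |u_i|^2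
       + 2 b <s, x - x_star> + c |x - x_star|^2],
    called [lyapunov] below.

    After the first step, [x + d s] is the previous iterate.  A step from [x]
    thus moves this point to [x] whatever index is drawn, so the first term of
    the potential goes from [g (x + d s)] to [g x], and convexity bounds this
    change by [- d <s, g'(x)>].  In the quadratic part, replacing the new
    iterate by [x - d s_new] turns the coefficients into those of
    [lyapunov_quadratic_step].  The constants are chosen for two cancellations
    in the mean over the drawn index: [a1] makes the coefficient of [|s_new|^2]
    equal to [d / 2], which cancels [<s, g'(x)>], and [b] makes the
    coefficient of [<s, x - x_star>] invariant.  What survives is the negative
    term [- <g'(x), x - x_star> / (2 n)], small multiples of [|s|^2] and
    [|u_i|^2] with a negative sign, and a variance term
    [sum_i |f_i'(x) - f_i'(x_star)|^2].  Cocoercivity of the gradients bounds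
    the variance by [n L <g'(x), x - x_star>], and the constants leave enough
    room to contract the whole potential.  [lyapunov_decrease] records the
    outcome: for [0 <= tau <= 1/8] and [tau / n <= mu / (16 L)],
    [mean of next <= (1 - tau / n) current - ((1/8 - tau) / 4) (g x - g x_star) / n].

    The potential dominates [g x - g x_star] ([lyapunov_ge]), and initially
    [s = 0] makes it at most [C0] ([lyapunov_init_zero],
    [lyapunov_init_centered]).  Taking [tau = n min (mu / (16 L), 1 / (8 n))]
    and iterating gives the linear rate; taking [tau = 0], summing the decrease
    and applying Jensen's inequality to the averaged iterate gives the
    [32 n / k] rate.

    The iterate after [k] steps depends on the first [k] draws only, and these
    are uniform over the [n ^ k] words of length [k]; expectations are thus
    finite averages over words ([expectation_draws]), for which the one-step
    inequality iterates by peeling off the last letter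
    ([draw_mean_geometric]). *)

(** * The Euclidean inner product *)

Definition dot (R : realType) (p : nat) (u v : 'rV[R]_p) : R :=
  \sum_(j < p) u 0 j * v 0 j.

Section InnerProduct.
Variables (R : realType) (p : nat).
Implicit Types (u v w : 'rV[R]_p) (a : R).

Lemma enorm_sqr u : enorm u ^+ 2 = dot u u.
Proof.
rewrite /enorm sqr_sqrtr; first by apply: eq_bigr => j _; rewrite expr2.
by apply: sumr_ge0 => j _; exact: sqr_ge0.
Qed.

Lemma dotC u v : dot u v = dot v u.
Proof. by apply: eq_bigr => j _; rewrite mulrC. Qed.

Lemma dotDl u v w : dot (u + v) w = dot u w + dot v w.
Proof. by rewrite -big_split; apply: eq_bigr => j _; rewrite mxE mulrDl. Qed.

Lemma dotZl a u v : dot (a *: u) v = a * dot u v.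
Proof. by rewrite mulr_sumr; apply: eq_bigr => j _; rewrite mxE mulrA. Qed.

Lemma dotDr u v w : dot w (u + v) = dot w u + dot w v.
Proof. by rewrite dotC dotDl !(dotC w). Qed.

Lemma dotZr a u v : dot u (a *: v) = a * dot u v.
Proof. by rewrite dotC dotZl dotC. Qed.

Lemma dotNl u v : dot (- u) v = - dot u v.
Proof. by rewrite -scaleN1r dotZl mulN1r. Qed.

Lemma dotNr u v : dot u (- v) = - dot u v.
Proof. by rewrite -scaleN1r dotZr mulN1r. Qed.

Lemma dot0l u : dot 0 u = 0.
Proof. by rewrite -(scale0r u) dotZl mul0r. Qed.

Lemma dot0r u : dot u 0 = 0.
Proof. by rewrite dotC dot0l. Qed.

Lemma dot_suml n (F : 'I_n -> 'rV[R]_p) v :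
  dot (\sum_i F i) v = \sum_i dot (F i) v.
Proof.
by elim/big_rec2: _ => [|i a u _ <-]; rewrite ?dot0l ?dotDl.
Qed.

Definition dotE := (dotDl, dotDr, dotNl, dotNr, dotZl, dotZr).

Lemma dot_sqrD u v : dot (u + v) (u + v) = dot u u + 2 * dot u v + dot v v.
Proof. by rewrite !dotE (dotC v u); ring. Qed.

Lemma dot_sqrB u v : dot (u - v) (u - v) = dot u u + dot v v - 2 * dot v u.
Proof. by rewrite !dotE (dotC u v); ring. Qed.

Lemma dot_ge0 u : 0 <= dot u u.
Proof. by rewrite -enorm_sqr sqr_ge0. Qed.

Lemma dot_eq0 u : dot u u = 0 -> u = 0.
Proof.
move/eqP; rewrite psumr_eq0 => [/allP u0|j _]; last by rewrite -expr2 sqr_ge0.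
apply/rowP => j; rewrite mxE; apply/eqP; rewrite -sqrf_eq0 expr2.
exact/u0/mem_index_enum.
Qed.

Lemma dot_young a u v :
  0 < a -> dot u v <= a / 2 * dot u u + (2 * a)^-1 * dot v v.
Proof.
move=> a0; have := dot_ge0 (a *: u - v); rewrite !dotE (dotC v u) => sq0.
rewrite -(ler_pM2l a0) mulrDr !mulrA.
have -> : a * (2 * a)^-1 = 2^-1 by field; exact: lt0r_neq0.
lra.
Qed.

(** The defect is [n] times the sum of the squared distances of the vectors to
    their mean. *)
Lemma dot_sum_sqr_le n (F : 'I_n -> 'rV[R]_p) :
  dot (\sum_i F i) (\sum_i F i) <= n%:R * \sum_i dot (F i) (F i).
Proof.
case: n F => [|n] F; first by rewrite !big_ord0 dot0l mul0r.
set S := \sum_i F i; set N : R := n.+1%:R.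
have N0 : 0 < N by rewrite ltr0n.
have : 0 <= \sum_i dot (F i - N^-1 *: S) (F i - N^-1 *: S).
  by apply: sumr_ge0 => i _; exact: dot_ge0.
have -> : \sum_i dot (F i - N^-1 *: S) (F i - N^-1 *: S) =
    \sum_i dot (F i) (F i) - N^-1 * dot S S.
  transitivity (\sum_i (dot (F i) (F i) - 2 * N^-1 * dot (F i) S +
                        N^-1 ^+ 2 * dot S S)).
    by apply: eq_bigr => i _; rewrite !dotE (dotC S (F i)); ring.
  rewrite !big_split/= sumrN -mulr_sumr -dot_suml sumr_const card_ord.
  by rewrite -mulr_natl -/S -/N; field; exact: lt0r_neq0.
by rewrite subr_ge0 ler_pdivrMl.
Qed.

Lemma dot_le_of_enorm_le u v a :
  0 <= a -> enorm u <= a * enorm v -> dot u u <= a ^+ 2 * dot v v.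
Proof.
move=> a0 uv; rewrite -!enorm_sqr -exprMn lerXn2r// nnegrE ?mulr_ge0 ?sqrtr_ge0//.
Qed.

End InnerProduct.

(** * Gradients and convexity *)

Section Gradient.
Variables (R : realType) (p : nat).
Implicit Types (h : 'rV[R]_p -> R) (x y v : 'rV[R]_p).

(** The gradient is defined by partial derivatives; differentiability makes it
    represent every directional derivative. *)
Lemma derive_dot_grad h x v :
  differentiable h x -> 'D_v h x = dot (grad h x) v.
Proof.
move=> dh; rewrite deriveE// {1}[v]row_sum_delta linear_sum /=.
by apply: eq_bigr => j _; rewrite linearZ/= mxE deriveE// mulrC.
Qed.

Lemma is_derive_line h x v (t : R) :
  differentiable h (x + t *: v) ->
  is_derive t 1 (fun s : R => h (x + s *: v)) (dot (grad h (x + t *: v)) v).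
Proof.
move=> dh; rewrite -derive_dot_grad//.
have dv : derivable h (x + t *: v) v by exact: diff_derivable.
have quotE : (fun s : R => s^-1 *: (((fun r : R => h (x + r *: v)) \o shift t)
      (s *: 1) - h (x + t *: v))) =
    (fun s : R => s^-1 *: ((h \o shift (x + t *: v)) (s *: v) -
      h (x + t *: v))).
  apply/funext => s /=; congr (_ *: (h _ - _)).
  by rewrite /shift/= [s%:A]mulr1 scalerDl addrCA.
by split; rewrite ?/derivable ?/derive quotE.
Qed.

Lemma strongly_convex0 h : convex h -> strongly_convex 0 h.
Proof.
rewrite /strongly_convex (_ : (fun z => _) = h)//; apply/funext => z.
by rewrite mul0r mul0r subr0.
Qed.

(** Expanding the squares in the convexity inequality of
    [h - mu / 2 |.|^2] along a segment leaves exactly the quadratic gain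
    [mu / 2 * t * (1 - t) * |v|^2]. *)
Lemma strongly_convex_line (mu : R) h x v (t : R) :
  strongly_convex mu h -> 0 <= t <= 1 ->
  h (x + t *: v) <=
    h x + t * (h (x + v) - h x - mu / 2 * (1 - t) * dot v v).
Proof.
move=> hc /andP[t0 t1].
have := hc (Itv01 t0 t1) (x + v) x; rewrite !in_setT => /(_ isT isT).
rewrite convRE /=.
have -> : conv (Itv01 t0 t1) (x + v : convex_lmodType _) x = x + t *: v.
  rewrite /conv/= /unstable.onem scalerDr scalerBl scale1r.
  by rewrite addrAC addrCA subrr addr0.
rewrite !enorm_sqr !dotE (dotC v x) /unstable.onem; lra.
Qed.

(** Divide the inequality along the segment by [t] and let [t] tend to 0 from
    the right.  The case [mu = 0] is the tangent inequality for convex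
    functions. *)
Lemma strongly_convex_grad (mu : R) h x y :
  strongly_convex mu h -> differentiable h x ->
  h x + dot (grad h x) (y - x) + mu / 2 * dot (y - x) (y - x) <= h y.
Proof.
move=> hc dh; set v := y - x.
have yE : h y = h (x + v) by rewrite /v addrC subrK.
have dv : derivable h x v by exact: diff_derivable.
rewrite -derive_dot_grad// addrAC -lerBrDl yE.
pose B (t : R) : R := h (x + v) - h x - mu / 2 * (1 - t) * dot v v.
have cB : B t @[t --> 0^'+] --> B 0.
  apply: cvg_at_right_filter; rewrite /B.
  apply: cvgB; first exact: cvg_cst.
  apply: cvgMr_tmp; apply: cvgMl_tmp; apply: cvgB; first exact: cvg_cst.
  exact: cvg_id.
suff : 'D_v h x <= B 0 by rewrite /B; lra.
apply: ler_cvg_to (cvg_dnbhs_at_right dv) cB _.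
near=> t.
have t0 : 0 < t by near: t; exact: nbhs_right_gt.
have t1 : t <= 1 by near: t; exact: nbhs_right_le.
rewrite -[leLHS]/(t^-1 * (h (t *: v + x) - h x)) ler_pdivrMl// lerBlDl.
rewrite [t *: v + x]addrC; apply: strongly_convex_line => //.
by rewrite ltW.
Unshelve. all: by end_near.
Qed.

(** The auxiliary function [psi] is [h] along the segment minus its claimed
    quadratic upper bound; smoothness makes its derivative nonpositive, and the
    mean value theorem concludes. *)
Lemma descent_lemma (L : R) h x v :
  (forall y, differentiable h y) ->
  (forall y z, dot (grad h y - grad h z) (grad h y - grad h z) <=
     L ^+ 2 * dot (y - z) (y - z)) -> 0 < L ->
  h (x + v) <= h x + dot (grad h x) v + L / 2 * dot v v.
Proof.
move=> dh hL L0.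
pose psi (t : R) : R := h (x + t *: v) - t * dot (grad h x) v -
  L / 2 * dot v v * t ^+ 2.
pose dpsi (t : R) : R := dot (grad h (x + t *: v)) v - dot (grad h x) v -
  L * dot v v * t.
have dpsiP (t : R) : is_derive t 1 psi (dpsi t).
  have ? := is_derive_line (dh (x + t *: v)).
  apply: is_derive_eq; rewrite /dpsi.
  (* The derivative comes out in terms of the scaling of [R] acting on itself. *)
  move: (dot (grad h _) v) (dot _ v) (dot v v) => a b c.
  by change (b - (t * 0 + a * 1) - L / 2 * c * (t * 1 + t * 1) =
    b - a - L * c * t :> R); field.
have [|c] := @MVT_segment R psi dpsi 0 1 ler01 (fun t _ => dpsiP t).
  by apply: derivable_within_continuous => t _; exact: ex_derive.
rewrite in_itv/= => /andP[c0 c1]; rewrite subr0 mulr1.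
suff : dpsi c <= 0.
  rewrite /psi /dpsi !(scale0r, scale1r) addr0; lra.
rewrite /dpsi; have [->|cn0] := eqVneq c 0.
  by rewrite scale0r addr0 subrr mulr0 subr0.
have cp : 0 < c by rewrite lt_neqAle eq_sym cn0.
have Lc : 0 < L * c by rewrite mulr_gt0.
have iLc : 0 < (L * c)^-1 by rewrite invr_gt0.
have := dot_young (grad h (x + c *: v) - grad h x) v iLc.
have := hL (x + c *: v) x; rewrite [x + _]addrC addrK !dotE => bound.
rewrite -(ler_pM2l iLc) in bound.
have e1 : (L * c)^-1 * (L ^+ 2 * (c * (c * dot v v))) = L * c * dot v v.
  by field; rewrite cn0 lt0r_neq0.
have e2 : (2 * (L * c)^-1)^-1 = L * c / 2 by field; rewrite cn0 lt0r_neq0.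
move: bound; rewrite e1 e2; lra.
Qed.

(** Strengthens the tangent inequality by the squared gradient difference.
    Compare the tangent at [x] with the upper bound of the descent lemma at [y],
    both evaluated at the gradient step [y - L^-1 w] from [y], where
    [w = grad h y - grad h x]: this is the step minimising the upper bound for
    [h] minus its tangent at [x]. *)
Lemma cocoercive (L : R) h x y :
  convex h -> (forall y, differentiable h y) ->
  (forall y z, dot (grad h y - grad h z) (grad h y - grad h z) <=
     L ^+ 2 * dot (y - z) (y - z)) -> 0 < L ->
  h x + dot (grad h x) (y - x) +
    (2 * L)^-1 * dot (grad h y - grad h x) (grad h y - grad h x) <= h y.
Proof.
move=> hc dh hL L0; set w := grad h y - grad h x.
have := descent_lemma y (- L^-1 *: w) dh hL L0.
have := strongly_convex_grad (y - L^-1 *: w) (strongly_convex0 hc) (dh x).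
rewrite scaleNr addrAC !dotE mul0r mul0r addr0 => lo hi.
have := le_trans lo hi.
have e1 : (2 * L)^-1 = L^-1 / 2 by field; exact: lt0r_neq0.
have e2 c d : L / 2 * - - (L^-1 * (L^-1 * c - L^-1 * d)) = L^-1 / 2 * (c - d).
  by field; exact: lt0r_neq0.
by rewrite e2 e1 (dotC (grad h y) (grad h x)); lra.
Qed.

End Gradient.

(** * The average objective *)

Section Average.
Variables (R : realType) (p n : nat) (f : 'I_n -> 'rV[R]_p -> R).
Hypothesis n_gt0 : (0 < n)%N.
Hypothesis f_diff : forall i x, differentiable (f i) x.

Lemma average_fctE :
  average f = (n%:R : R)^-1 \*: (\sum_i f i).
Proof. by apply/funext => x; rewrite /average/= fct_sumE. Qed.

Lemma differentiable_average x : differentiable (average f) x.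
Proof.
rewrite average_fctE; apply: differentiableZ.
by apply: differentiable_sum => i; exact: f_diff.
Qed.

Lemma grad_average x :
  grad (average f) x = n%:R^-1 *: \sum_i grad (f i) x.
Proof.
apply/rowP => j; rewrite !mxE summxE average_fctE.
have df i : derivable (f i) x (delta_mx 0 j) by exact: diff_derivable.
rewrite deriveZ ?derive_sum//; last exact: derivable_sum.
by congr (_ * _); apply: eq_bigr => i _; rewrite mxE.
Qed.

Variable L : R.
Hypothesis L_gt0 : 0 < L.
Hypothesis f_smooth : forall i y z,
  dot (grad (f i) y - grad (f i) z) (grad (f i) y - grad (f i) z) <=
    L ^+ 2 * dot (y - z) (y - z).

Lemma grad_average_smooth y z :
  dot (grad (average f) y - grad (average f) z)
      (grad (average f) y - grad (average f) z) <=
    L ^+ 2 * dot (y - z) (y - z).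
Proof.
have N0 : 0 < n%:R :> R by rewrite ltr0n.
rewrite !grad_average -scalerBr -sumrB dotZl dotZr.
rewrite ler_pdivrMl// ler_pdivrMl//.
apply: (le_trans (dot_sum_sqr_le _)).
rewrite ler_pM2l// mulr_natl -[in leRHS](card_ord n) -sumr_const.
by apply: ler_sum => i _; exact: f_smooth.
Qed.

(** At a minimizer a gradient step of length [1 / L] cannot decrease the
    objective, whereas the descent lemma promises a decrease by
    [|grad|^2 / (2 L)]. *)
Lemma grad_average_min xs :
  (forall x, average f xs <= average f x) -> grad (average f) xs = 0.
Proof.
move=> xs_min; set w := grad _ _.
have := descent_lemma xs (- L^-1 *: w) differentiable_average
  grad_average_smooth L_gt0.
move/(le_trans (xs_min _)); rewrite -/w !dotE => h.
apply: dot_eq0; apply/eqP; rewrite eq_le dot_ge0 andbT.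
have e : L / 2 * (- L^-1 * (- L^-1 * dot w w)) = L^-1 / 2 * dot w w.
  by field; exact: lt0r_neq0.
have iL : 0 < L^-1 by rewrite invr_gt0.
by rewrite -(pmulr_rle0 _ iL); move: h; rewrite e; lra.
Qed.

End Average.

(** * The scalar inequality behind the decrease of the potential *)

(** The coefficients of the potential.  The value of [lyap_a1] is [d / 2] minus
    what the substitution [x - d s] contributes to the coefficient of [|s|^2],
    with [d = 1 / (16 N L)]. *)
Definition lyap_a1 (R : realType) (L N : R) : R :=
  (32 * N * L)^-1 * (1 - N^-1 + (2 * N ^+ 2)^-1).
Definition lyap_a2 (R : realType) (L N : R) : R := (16 * N * L)^-1.
Definition lyap_b (R : realType) (N : R) : R := - (4 * N)^-1 * (1 - N^-1).
Definition lyap_c (R : realType) (L N : R) : R := 4 * L / N.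

(** Here [s], [u], [v] are [|s|^2], [sum |u_i|^2], [sum |v_i|^2] divided by
    [N L], with [v_i = f_i'(x) - f_i'(x_star)], [m = 1 / N],
    [y = mu |x - x_star|^2] and [z = tau (L / N) |x - x_star|^2]; [sw] and [uv]
    are inner products divided by [N L], and [sX] is one divided by [N].  Each
    term is estimated linearly.  The budget is tight in [s], where
    [7 / 256 = 1 / 256 + 6 / 256] balances the cross terms [sw] and [sX], and in
    [u], where [3 / 128] is what [uv] consumes; the remaining [G], [v] and [z]
    terms are paid for by [D / 2]. *)
Lemma lyap_normalized_decrease (R : realType) (D G tau m s u v y z sw uv sX : R) :
  0 <= tau -> tau <= 1 / 8 -> 0 <= m -> m <= 1 ->
  0 <= G -> 0 <= s -> 0 <= u -> 0 <= v -> 0 <= z ->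
  y / 2 <= G -> G + y / 2 <= D -> v <= D -> z <= y / 16 ->
  sw <= m / 2 * s + v / 2 ->
  - uv <= 3 / 8 * u + 2 / 3 * v ->
  - (tau * sX) <= tau * (3 / 8 * s) + 2 / 3 * z ->
  0 <= 1 / 2 * D - tau * G - (1 / 8 - tau) / 4 * G
    - tau / 16 * sw + s / 32 * (1 + m / 2 - tau * (1 - m + m ^+ 2 / 2))
    + u * ((1 - tau) / 16 - 1 / 32) - 3 / 32 * v + uv / 16
    + (1 - m) / 2 * (tau * sX) - 4 * z.
Proof.
move=> t0 t1 m0 m1 G0 s0 u0 v0 z0 yG yD vD z_le sw_le uv_le sX_le.
have ms0 : 0 <= m * s by exact: mulr_ge0.
have ms : m * s <= s by rewrite ler_piMl.
have mm : m ^+ 2 <= m by rewrite expr2 ler_piMl.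
have mm0 : 0 <= m ^+ 2 by exact: sqr_ge0.
have ts : tau * s <= 1 / 8 * s by rewrite ler_wpM2r.
have ts0 : 0 <= tau * s by rewrite mulr_ge0.
have Gterm : tau * G + (1 / 8 - tau) / 4 * G <= G / 8.
  have t8 : 0 <= 1 / 8 - tau by lra.
  by have := mulr_ge0 t8 G0; lra.
have swterm : tau / 16 * sw <= (s + v) / 256.
  have := ler_wpM2l t0 sw_le => h.
  have : tau * (m / 2 * s + v / 2) <= 1 / 8 * ((s + v) / 2).
    by apply: ler_pM => //; lra.
  by move: h; clear; lra.
have sterm : 7 / 256 * s <= s / 32 * (1 + m / 2 - tau * (1 - m + m ^+ 2 / 2)).
  have h : tau * (1 - m + m ^+ 2 / 2) <= 1 / 8 * 1 by apply: ler_pM => //; lra.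
  have : 0 <= s * (1 + m / 2 - tau * (1 - m + m ^+ 2 / 2) - 7 / 8).
    by rewrite mulr_ge0//; lra.
  by clear; lra.
have uterm : 3 / 128 * u <= u * ((1 - tau) / 16 - 1 / 32).
  by rewrite mulrC ler_wpM2l//; lra.
have Xterm : - (3 / 128 * s + z / 3) <= (1 - m) / 2 * (tau * sX).
  rewrite lerNl -mulrN.
  have [neg|pos] := lerP (- (tau * sX)) 0.
    apply: (@le_trans _ _ 0); last by lra.
    by rewrite mulr_ge0_le0//; lra.
  have -> : 3 / 128 * s + z / 3 = 1 / 2 * (3 / 64 * s + 2 / 3 * z) by field.
  by apply: ler_pM; [lra|exact: ltW|lra|lra].
move: G0 Gterm swterm sterm uterm Xterm uv_le z_le vD yD yG; clear; lra.
Qed.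

(** The decrease of the potential once all inner products are named:
    [G] is the optimality gap at [x], [D] is [<g'(x), x - x_star>], [X] and [S]
    are [|x - x_star|^2] and [|s|^2], [U], [V] and [uv] are the sums of
    [|u_i|^2], [|v_i|^2] and [<u_i, v_i>], [W] is [|g'(x)|^2], [sw] and [sX] are
    the inner products of [s] with [g'(x)] and [x - x_star], and [gz] is the gap
    at [x + d s].  The weights in the three Young inequalities are the ones
    that make the final budget balance. *)
Lemma lyap_scalar_decrease (R : realType) (L N mu tau : R)
    (G D X S U V W sw uv sX gz : R) :
  0 < L -> 1 <= N -> 0 <= tau -> tau <= 1 / 8 -> tau / N <= mu / (16 * L) ->
  0 <= X -> 0 <= S -> 0 <= V -> 0 <= U ->
  mu / 2 * X <= G -> G + mu / 2 * X <= D ->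
  V <= N * L * D -> W <= N^-1 * V ->
  G + (16 * N * L)^-1 * sw <= gz ->
  sw <= (2 * N)^-1 * S + N / 2 * W ->
  - uv <= 3 / 8 * U + 2 / 3 * V ->
  - sX <= 3 / (8 * L) * S + 2 * L / 3 * X ->
  G + (32 * N * L)^-1 * (S + 2 * (sw - N^-1 * S) + N^-1 * (V + U - 2 * uv))
    + lyap_a2 L N * (U + N^-1 * (V - U))
    - (2 * N)^-1 * (sX + D - N^-1 * sX) + lyap_c L N * X
  <= (1 - tau / N) * (gz + lyap_a1 L N * S + lyap_a2 L N * U
       + 2 * lyap_b N * sX + lyap_c L N * X) - N^-1 * ((1 / 8 - tau) / 4 * G).
Proof.
move=> L0 N1 t0 t1 tmu X0 S0 V0 U0 GX DG VD WV gzG sw_le uv_le sX_le.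
have N0 : 0 < N by lra.
have Nn : N != 0 by exact: lt0r_neq0.
have Ln : L != 0 by exact: lt0r_neq0.
have iN0 : 0 < N^-1 by rewrite invr_gt0.
have iN1 : N^-1 <= 1 by rewrite invf_le1.
have G0 : 0 <= G.
  have : 0 <= tau / N by rewrite divr_ge0 ?(ltW N0).
  move=> /le_trans /(_ tmu); rewrite pmulr_lge0; last by rewrite invr_gt0; lra.
  by move=> mu0; apply: le_trans GX; rewrite mulr_ge0// divr_ge0.
have gz_lo : (1 - tau / N) * (G + (16 * N * L)^-1 * sw) <= (1 - tau / N) * gz.
  rewrite ler_wpM2l// subr_ge0 (@le_trans _ _ tau)//; last by lra.
  by rewrite ler_piMr.
(* Multiplying by [N] and measuring squared gradients in units of [N L] removes
   [N] and [L] from the inequality, up to [m = 1 / N]. *)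
pose q := (N * L)^-1.
have q0 : 0 <= q by rewrite invr_ge0 mulr_ge0 ?ltW.
pose s := q * S; pose u := q * U; pose v := q * V; pose m := N^-1.
pose y := mu * X; pose z := tau * (N^-1 * L * X).
have s0 : 0 <= s by exact: mulr_ge0.
have u0 : 0 <= u by exact: mulr_ge0.
have v0 : 0 <= v by exact: mulr_ge0.
have m0 : 0 <= m by exact: ltW.
have vD : v <= D.
  by rewrite /v /q ler_pdivrMl ?mulr_gt0.
have sw' : q * sw <= m / 2 * s + v / 2.
  apply: (le_trans (ler_wpM2l q0 sw_le)); rewrite mulrDr; apply: lerD.
    by rewrite /s /m le_eqVlt; apply/orP/or_introl/eqP; field.
  have := ler_wpM2l q0 (ler_wpM2l (ltW N0) WV); rewrite mulVKf// /v; lra.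
have uv' : - (q * uv) <= 3 / 8 * u + 2 / 3 * v.
  have := ler_wpM2l q0 uv_le; rewrite /u /v; lra.
have z_le : z <= y / 16.
  have := ler_wpM2r X0 (ler_wpM2l (ltW L0) tmu).
  have -> : L * (mu / (16 * L)) * X = y / 16 by rewrite /y; field.
  by apply: le_trans; rewrite /z le_eqVlt; apply/orP/or_introl/eqP; field.
have z0 : 0 <= z.
  by rewrite /z mulr_ge0// mulr_ge0// mulr_ge0// ltW.
have sX' : - (tau * (N^-1 * sX)) <= tau * (3 / 8 * s) + 2 / 3 * z.
  have := ler_wpM2l t0 (ler_wpM2l m0 sX_le).
  have -> : tau * (m * (3 / (8 * L) * S + 2 * L / 3 * X)) =
      tau * (3 / 8 * s) + 2 / 3 * z by rewrite /s /z /q /m; field; rewrite Ln Nn.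
  by rewrite /m; lra.
rewrite -subr_ge0 -(pmulr_rge0 _ N0).
apply: (@le_trans _ _ (1 / 2 * D - tau * G - (1 / 8 - tau) / 4 * G
  - tau / 16 * (q * sw) + s / 32 * (1 + m / 2 - tau * (1 - m + m ^+ 2 / 2))
  + u * ((1 - tau) / 16 - 1 / 32) - 3 / 32 * v + (q * uv) / 16
  + (1 - m) / 2 * (tau * (N^-1 * sX)) - 4 * z)); last first.
  have := ler_wpM2l (ltW N0) gz_lo; rewrite -subr_ge0 => h.
  rewrite -subr_ge0; apply: le_trans h _.
  rewrite le_eqVlt; apply/orP/or_introl/eqP.
  rewrite /s /u /v /q /m /z /lyap_a1 /lyap_a2 /lyap_b /lyap_c.
  by field; rewrite Ln Nn.
apply: (@lyap_normalized_decrease R D G tau m s u v y z (q * sw) (q * uv)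
  (N^-1 * sX)) => //; rewrite /y; lra.
Qed.

(** * Averages over the index draws *)

Section DrawMean.
Variables (R : realType) (n : nat).
Hypothesis n_gt0 : (0 < n)%N.
Implicit Types phi psi : seq 'I_n -> R.

Definition draw_mean k phi : R := n%:R ^- k * \sum_(t : k.-tuple 'I_n) phi t.

Lemma draw_mean0 phi : draw_mean 0 phi = phi [::].
Proof.
rewrite /draw_mean expr0 invr1 mul1r (big_pred1 [tuple])// => t.
by rewrite [t]tuple0; apply/esym/eqP.
Qed.

(** Conditioning on the first [k] draws. *)
Lemma draw_meanS k phi :
  draw_mean k.+1 phi = draw_mean k (fun t => n%:R^-1 * \sum_i phi (rcons t i)).
Proof.
rewrite /draw_mean -mulr_sumr mulrA -invfM -exprSr; congr (_ * _).
rewrite pair_big/=.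
rewrite (reindex (fun ti : k.-tuple 'I_n * 'I_n => [tuple of rcons ti.1 ti.2]))//=.
exists (fun t : k.+1.-tuple 'I_n =>
  ([tuple tnth t (widen_ord (leqnSn k) j) | j < k], tnth t ord_max)).
- move=> [t i] _ /=; congr pair.
    apply: eq_from_tnth => j; rewrite tnth_mktuple !(tnth_nth i)/=.
    by rewrite nth_rcons size_tuple ltn_ord.
  by rewrite (tnth_nth i)/= nth_rcons size_tuple ltnn eqxx.
- move=> t _ /=; apply: eq_from_tnth => j; rewrite (tnth_nth (tnth t ord_max))/=.
  rewrite nth_rcons size_map size_enum_ord.
  have [jk|kj] := ltnP j k.
    rewrite (nth_map (Ordinal jk)) ?size_enum_ord//.
    by congr tnth; apply: val_inj => /=; rewrite nth_enum_ord.
  have jk : j = k :> nat by apply/eqP; rewrite eqn_leq kj -ltnS ltn_ord.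
  by rewrite jk eqxx; congr tnth; apply: val_inj.
Qed.

Lemma ler_draw_mean k phi psi :
  (forall t, size t = k -> phi t <= psi t) -> draw_mean k phi <= draw_mean k psi.
Proof.
move=> le; rewrite ler_wpM2l ?invr_ge0 ?exprn_ge0//.
by apply: ler_sum => t _; apply: le; rewrite size_tuple.
Qed.

Lemma draw_mean_affine k (a c : R) phi :
  draw_mean k (fun t => c + a * phi t) = c + a * draw_mean k phi.
Proof.
rewrite /draw_mean big_split/= sumr_const card_tuple card_ord -mulr_sumr.
rewrite mulrDr -[c *+ _]mulr_natl natrX mulKf ?expf_neq0 ?pnatr_eq0 -?lt0n//.
by rewrite mulrCA.
Qed.

Lemma draw_mean_geometric (rho : R) phi :
  0 <= rho ->
  (forall t, n%:R^-1 * \sum_i phi (rcons t i) <= rho * phi t) ->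
  forall k, draw_mean k phi <= rho ^+ k * phi [::].
Proof.
move=> rho0 step; elim=> [|k IH]; first by rewrite draw_mean0 expr0 mul1r.
rewrite draw_meanS exprS -mulrA.
apply: le_trans (ler_wpM2l rho0 IH).
have := draw_mean_affine k rho 0 phi; rewrite add0r => <-.
by apply: ler_draw_mean => t _; rewrite add0r.
Qed.

(** The random word is a simple random variable: it takes each of the [n ^ k]
    values [t] on a measurable event [A t], whose probability is [n ^- k] by
    independence and uniformity. *)
Lemma expectation_draws (d : measure_display) (T : measurableType d)
    (P : probability T R) (idx : nat -> T -> 'I_n) k phi :
  uniform_iid P idx ->
  ('E_P[fun w => phi (mkseq (idx ^~ w) k)] = (draw_mean k phi)%:E)%E.
Proof.
case=> idx_meas idx_unif idx_indep.
pose i0 : 'I_n := Ordinal n_gt0.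
pose A (t : k.-tuple 'I_n) : set T :=
  \bigcap_(j in [set` iota 0 k]) (idx j @^-1` [set nth i0 t j]).
have mA t : measurable (A t).
  by apply: fin_bigcap_measurable => [|j _]; [exact: finite_seq|exact: idx_meas].
have PA t : P (A t) = (n%:R ^- k)%:E.
  rewrite /A (idx_indep (iota 0 k) (fun j => [set nth i0 t j]))//; last first.
    exact: iota_uniq.
  under eq_bigr => j _ do rewrite idx_unif.
  rewrite -exprVn -[in RHS](size_iota 0 k); elim: (iota 0 k) => [|j s IH].
    by rewrite big_nil.
  by rewrite big_cons IH -EFinM -exprS.
have memA t w : A t w <-> mkseq (idx ^~ w) k = t.
  split=> [Aw|tE j /=]; last first.
    by rewrite mem_iota => /andP[_ jk]; rewrite -tE nth_mkseq.
  apply: (@eq_from_nth _ i0) => [|j]; rewrite size_mkseq ?size_tuple// => jk.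
  by rewrite nth_mkseq//; apply: (Aw j); rewrite /= mem_iota.
rewrite unlock.
have phiE w : (phi (mkseq (idx ^~ w) k))%:E =
    (\sum_(t : k.-tuple 'I_n) (phi t)%:E * (\1_(A t) w)%:E)%E.
  pose tw : k.-tuple 'I_n := Tuple (introT eqP (size_mkseq (idx ^~ w) k)).
  rewrite (bigD1 tw)//= big1 => [|t /eqP ttw].
    by rewrite adde0 indicE mem_set ?mule1//; apply/memA.
  rewrite indicE memNset ?mule0// => /memA tE.
  by apply: ttw; apply: val_inj; rewrite /= -tE.
under eq_integral => w _ do rewrite phiE.
rewrite integral_sum//; last first.
  by move=> t; apply: integrableZl => //; exact: integrable_indic.
rewrite /draw_mean mulr_sumr -sumEFin; apply: eq_bigr => t _.
rewrite integralZl//; last exact: integrable_indic.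
transitivity ((phi t)%:E * P (A t))%E; last by rewrite PA -EFinM mulrC.
by rewrite integral_indic// setIT.
Qed.

End DrawMean.

(** * SAG as a function of a word of draws *)

Section Run.
Variables (R : realType) (p n : nat) (f : 'I_n -> 'rV[R]_p -> R).
Variables (alpha : R) (x0 : 'rV[R]_p) (y0 : 'I_n -> 'rV[R]_p).

(** The scheme is replayed on finite words of draws, so that expectations become
    [draw_mean]s. *)
Definition sag_step (st : 'rV[R]_p * ('I_n -> 'rV[R]_p))
    (i : 'I_n) : 'rV[R]_p * ('I_n -> 'rV[R]_p) :=
  let y' := fun j => if j == i then grad (f j) st.1 else st.2 j in
  (st.1 - (alpha / n%:R) *: \sum_j y' j, y').

Definition sag_run (t : seq 'I_n) : 'rV[R]_p * ('I_n -> 'rV[R]_p) :=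
  foldl sag_step (x0, y0) t.

Lemma sag_run_rcons t i : sag_run (rcons t i) = sag_step (sag_run t) i.
Proof. by rewrite /sag_run foldl_rcons. Qed.

Lemma sag_state_run (s : nat -> 'I_n) k :
  sag_state f alpha x0 y0 s k = sag_run (mkseq s k).
Proof.
elim: k => [//|k IH]; rewrite mkseqS sag_run_rcons -IH /=.
by case: (sag_state _ _ _ _ _ _).
Qed.

Lemma sag_mean_run (s : nat -> 'I_n) k :
  sag_mean f alpha x0 y0 s k =
  k%:R^-1 *: \sum_(j < k) (sag_run (take j (mkseq s k))).1.
Proof.
congr (_ *: _); apply: eq_bigr => j _.
by rewrite /sag sag_state_run -map_take take_iota (minn_idPl (ltnW (ltn_ord j))).
Qed.

End Run.

(** * The potential along SAG *)

Section Lyapunov.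
Variables (R : realType) (p n : nat) (f : 'I_n -> 'rV[R]_p -> R) (L : R).
Hypothesis n_gt0 : (0 < n)%N.
Hypothesis L_gt0 : 0 < L.
Hypothesis f_convex : forall i, convex (f i).
Hypothesis f_diff : forall i x, differentiable (f i) x.
Hypothesis f_smooth : forall i y z,
  dot (grad (f i) y - grad (f i) z) (grad (f i) y - grad (f i) z) <=
    L ^+ 2 * dot (y - z) (y - z).
Variable xs : 'rV[R]_p.
Hypothesis xs_min : forall x, average f xs <= average f x.

Let N : R := n%:R.
Let g := average f.

Definition lyapunov (st : 'rV[R]_p * ('I_n -> 'rV[R]_p)) : R :=
  let s := \sum_i st.2 i in
  let u := fun i => st.2 i - grad (f i) xs in
  average f (st.1 + (16 * n%:R * L)^-1 *: s) - average f xs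
  + lyap_a1 L n%:R * dot s s + lyap_a2 L n%:R * (\sum_i dot (u i) (u i))
  + 2 * lyap_b n%:R * dot s (st.1 - xs)
  + lyap_c L n%:R * dot (st.1 - xs) (st.1 - xs).

Let N_gt0 : 0 < N. Proof. by rewrite ltr0n. Qed.
Let N_ge1 : 1 <= N. Proof. by rewrite ler1n. Qed.
Let Nn : N != 0. Proof. exact: lt0r_neq0. Qed.
Let Ln : L != 0. Proof. exact: lt0r_neq0. Qed.

Lemma sum_grad_min : \sum_i grad (f i) xs = 0.
Proof.
have := grad_average_min n_gt0 f_diff L_gt0 f_smooth xs_min.
rewrite grad_average// => /eqP; rewrite scaler_eq0 invr_eq0.
by rewrite (negPf (Nn : n%:R != 0 :> R)) => /eqP.
Qed.

Lemma average_grad_le x y : g x + dot (grad g x) (y - x) <= g y.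
Proof.
rewrite /g grad_average// dotZl dot_suml /average -mulrDr -big_split/=.
rewrite ler_pM2l ?invr_gt0//; apply: ler_sum => i _.
have := strongly_convex_grad y (strongly_convex0 (f_convex i)) (f_diff i x).
by rewrite mul0r mul0r addr0.
Qed.

(** This identity fixes the constants: the coefficient of [|s|^2] becomes
    [d / 2], and that of [<s, x - x_star>] becomes [- (2 N)^-1], which the mean
    factor [1 - N^-1] of [mean_lyapunov_step] brings back to [2 b]. *)
Lemma lyapunov_quadratic_step (d : R) (s X : 'rV[R]_p) :
  d = (16 * N * L)^-1 ->
  lyap_a1 L N * dot s s + 2 * lyap_b N * dot s (X - d *: s)
    + lyap_c L N * dot (X - d *: s) (X - d *: s) =
  (32 * N * L)^-1 * dot s s - (2 * N)^-1 * dot s X + lyap_c L N * dot X X.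
Proof.
move=> ->; rewrite !dotE (dotC X s) /lyap_a1 /lyap_b /lyap_c.
by field; rewrite Ln Nn.
Qed.

(** With [x] the current iterate, the point [x_new + d s_new] of the new state
    is [x] itself, so the drawn index enters through quadratic terms only. *)
Lemma lyapunov_step x y i :
  let s := \sum_j y j in
  let X := x - xs in
  let u := y i - grad (f i) xs in
  let v := grad (f i) x - grad (f i) xs in
  lyapunov (sag_step f (1 / (16 * L)) (x, y) i) =
  g x - g xs
  + (32 * N * L)^-1 * (dot s s + 2 * dot s (v - u) + dot (v - u) (v - u))
  + lyap_a2 L N * (\sum_j dot (y j - grad (f j) xs) (y j - grad (f j) xs)
      - dot u u + dot v v)
  - (2 * N)^-1 * (dot s X + dot (v - u) X) + lyap_c L N * dot X X.
Proof.
move=> s X u v; rewrite /lyapunov /sag_step /=.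
have dE : 1 / (16 * L) / n%:R = (16 * N * L)^-1 by rewrite -/N; field; rewrite Ln Nn.
rewrite dE -/N; set d := (16 * N * L)^-1.
pose y' j := if j == i then grad (f j) x else y j.
have -> : \sum_j (if j == i then grad (f j) x else y j) = s + (v - u).
  have -> : v - u = grad (f i) x - y i by rewrite /v /u opprB addrA subrK.
  rewrite /s (bigD1 i)//= eqxx [in RHS](bigD1 i)//=.
  under eq_bigr => j /negPf -> do [].
  by rewrite [RHS]addrC -addrA addKr.
have -> : \sum_j dot (y' j - grad (f j) xs) (y' j - grad (f j) xs) =
    \sum_j dot (y j - grad (f j) xs) (y j - grad (f j) xs)
      - dot u u + dot v v.
  rewrite (bigD1 i)//= [in RHS](bigD1 i)//= {1 2}/y' eqxx -/u -/v.
  under eq_bigr => j /negPf ji do rewrite /y' ji.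
  by rewrite [dot u u + _]addrC addrK addrC.
set s' := s + (v - u).
rewrite subrK.
have -> : x - d *: s' - xs = X - d *: s' by exact: addrAC.
have := lyapunov_quadratic_step s' X (erefl d).
have -> : dot s' X = dot s X + dot (v - u) X by exact: dotDl.
have -> : dot s' s' = dot s s + 2 * dot s (v - u) + dot (v - u) (v - u)
  by exact: dot_sqrD.
rewrite /g; lra.
Qed.

Lemma grad_average_sub x :
  \sum_i (grad (f i) x - grad (f i) xs) = N *: grad g x.
Proof.
by rewrite sumrB sum_grad_min subr0 /g grad_average// scalerA divff// scale1r.
Qed.

(** In the mean, the replacement of one entry moves [s] by [g'(x) - s / N],
    because the gradients at the minimizer sum to zero. *)
Lemma mean_lyapunov_step x y :
  let s := \sum_j y j in
  let X := x - xs in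
  let w := grad g x in
  let u := fun i => y i - grad (f i) xs in
  let v := fun i => grad (f i) x - grad (f i) xs in
  let U := \sum_i dot (u i) (u i) in
  let V := \sum_i dot (v i) (v i) in
  N^-1 * \sum_i lyapunov (sag_step f (1 / (16 * L)) (x, y) i) =
  g x - g xs
  + (32 * N * L)^-1 * (dot s s + 2 * (dot s w - N^-1 * dot s s)
      + N^-1 * (V + U - 2 * \sum_i dot (u i) (v i)))
  + lyap_a2 L N * (U + N^-1 * (V - U))
  - (2 * N)^-1 * (dot s X + dot w X - N^-1 * dot s X)
  + lyap_c L N * dot X X.
Proof.
move=> s X w u v U V; pose r i := v i - u i.
have rE : \sum_i r i = N *: w - s.
  rewrite sumrB grad_average_sub; congr (_ - _).
  by rewrite sumrB sum_grad_min subr0.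
have sr : \sum_i dot s (r i) = N * dot s w - dot s s.
  under eq_bigr => i _ do rewrite dotC.
  by rewrite -dot_suml rE !dotE (dotC w s).
have rX : \sum_i dot (r i) X = N * dot w X - dot s X.
  by rewrite -dot_suml rE !dotE.
have rr : \sum_i dot (r i) (r i) = V + U - 2 * \sum_i dot (u i) (v i).
  rewrite mulr_sumr -big_split -sumrB; apply: eq_bigr => i _.
  exact: dot_sqrB.
under eq_bigr => i _ do rewrite lyapunov_step -/(u i) -/(v i) -/(r i) -/U -/s -/X.
have [K KE] : exists K, K = g x - g xs + (32 * N * L)^-1 * dot s s
    + lyap_a2 L N * U - (2 * N)^-1 * dot s X + lyap_c L N * dot X X.
  by eexists.
transitivity (N^-1 * \sum_i (K + (32 * N * L)^-1 * 2 * dot s (r i) +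
    (32 * N * L)^-1 * dot (r i) (r i) - lyap_a2 L N * dot (u i) (u i)
    + lyap_a2 L N * dot (v i) (v i) - (2 * N)^-1 * dot (r i) X)).
  by congr (_ * _); apply: eq_bigr => i _; rewrite KE; ring.
rewrite !big_split/= !sumrN -!mulr_sumr sr rr rX sumr_const card_ord.
rewrite -mulr_natl -/N -/U -/V KE /lyap_a2.
by field; rewrite Ln Nn.
Qed.

(** One statement serves both rates: strong convexity enters through its
    gradient inequality, which for [mu = 0] is plain convexity.  The factor
    [1 / 8 - tau] keeps a multiple of the gap when [tau = 0] and vanishes at the
    largest admissible [tau]. *)
Lemma lyapunov_decrease (mu tau : R) x y :
  (forall x' y', g x' + dot (grad g x') (y' - x') +
     mu / 2 * dot (y' - x') (y' - x') <= g y') ->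
  0 <= tau -> tau <= 1 / 8 -> tau / N <= mu / (16 * L) ->
  N^-1 * \sum_i lyapunov (sag_step f (1 / (16 * L)) (x, y) i) <=
  (1 - tau / N) * lyapunov (x, y)
    - N^-1 * ((1 / 8 - tau) / 4 * (g x - g xs)).
Proof.
move=> g_sc t0 t1 tmu; rewrite mean_lyapunov_step /lyapunov /= -/N.
set s := \sum_j y j; set X := x - xs; set w := grad g x.
set U := \sum_i dot (y i - grad (f i) xs) (y i - grad (f i) xs).
set V := \sum_i dot (grad (f i) x - grad (f i) xs) (grad (f i) x - grad (f i) xs).
set uv := \sum_i dot (y i - grad (f i) xs) (grad (f i) x - grad (f i) xs).
have gxs0 := grad_average_min n_gt0 f_diff L_gt0 f_smooth xs_min.
rewrite -/g in gxs0.
have WV : dot w w <= N^-1 * V.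
  have := dot_sum_sqr_le (fun i => grad (f i) x - grad (f i) xs).
  rewrite grad_average_sub !dotE -/w -/V -/N mulrCA ler_pM2l//.
  by rewrite ler_pdivlMl.
apply: (@lyap_scalar_decrease _ L N mu tau _ _ _ _ _ _ (dot w w)) => //;
  rewrite ?dot_ge0 ?sumr_ge0//.
- by move=> i _; exact: dot_ge0.
- by move=> i _; exact: dot_ge0.
- by have := g_sc xs x; rewrite gxs0 dot0l; lra.
- have := g_sc x xs; rewrite -/w -(opprB x xs) -/X !dotE; lra.
- rewrite mulrAC -ler_pdivrMr// -/X -dotZl -grad_average_sub dot_suml.
  rewrite mulr_suml; apply: ler_sum => i _.
  set v := _ - grad (f i) xs.
  have := cocoercive x xs (f_convex i) (f_diff i) (@f_smooth i) L_gt0.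
  have := cocoercive xs x (f_convex i) (f_diff i) (@f_smooth i) L_gt0.
  rewrite -(opprB (grad (f i) x)) -(opprB x xs) -/X -/v !(dotNl, dotNr) opprK.
  have -> : (2 * L)^-1 = L^-1 / 2 by field.
  have -> : dot v X = dot (grad (f i) x) X - dot (grad (f i) xs) X.
    by rewrite !dotE.
  rewrite mulrC; lra.
- have := average_grad_le x (x + (16 * N * L)^-1 *: s).
  rewrite [x + _]addrC addrK dotZr (dotC _ s) -/w -/g; lra.
- have := dot_young s w (a := N^-1); rewrite invr_gt0 => /(_ N_gt0).
  have -> : N^-1 / 2 = (2 * N)^-1 by field.
  by have -> : (2 / N)^-1 = N / 2 by field.
- rewrite -sumrN !mulr_sumr -big_split; apply: ler_sum => i _ /=.
  set ui := y i - _; set vi := _ - grad (f i) xs.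
  have := dot_young (- ui) vi (a := 3 / 4); rewrite !(dotNl, dotNr) opprK; lra.
- have := dot_young (- s) X (a := 3 / (4 * L)).
  rewrite !(dotNl, dotNr) opprK divr_gt0 ?mulr_gt0// => /(_ isT).
  have -> : 3 / (4 * L) / 2 = 3 / (8 * L) by field.
  by have -> : (2 * (3 / (4 * L)))^-1 = 2 * L / 3 by field.
Qed.

(** Convexity replaces [g (x + d s)] by [g x + d <s, g'(x)>]; the two cross
    terms in [s] are then absorbed by the squares, using [|g'(x)| <= L |x - x_star|]
    and, since [a1] alone falls short of the required [1 / (32 N L)], also
    [|s|^2 <= N sum_i |u_i|^2]. *)
Lemma lyapunov_ge x y : g x - g xs <= lyapunov (x, y).
Proof.
rewrite /lyapunov /= -/N.
set s := \sum_j y j; set X := x - xs; set w := grad g x.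
set U := \sum_i dot (y i - grad (f i) xs) (y i - grad (f i) xs).
have gxs0 := grad_average_min n_gt0 f_diff L_gt0 f_smooth xs_min.
rewrite -/g in gxs0.
have gz : g x + (16 * N * L)^-1 * dot s w <= g (x + (16 * N * L)^-1 *: s).
  have := average_grad_le x (x + (16 * N * L)^-1 *: s).
  by rewrite [x + _]addrC addrK dotZr (dotC _ s).
have WX : dot w w <= L ^+ 2 * dot X X.
  have := grad_average_smooth n_gt0 f_diff f_smooth x xs.
  by rewrite -/g gxs0 subr0.
have SU : dot s s <= N * U.
  have := dot_sum_sqr_le (fun i => y i - grad (f i) xs).
  by rewrite sumrB sum_grad_min subr0.
have sw : - dot s w <= 1 / 6 * dot s s + 3 / 2 * dot w w.
  have := dot_young (- s) w (a := 1 / 3); rewrite !(dotNl, dotNr) opprK; lra.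
have sX : dot s X <= (24 * L)^-1 * dot s s + 6 * L * dot X X.
  have := dot_young s X (a := (12 * L)^-1).
  rewrite invr_gt0 mulr_gt0// => /(_ isT).
  have -> : (12 * L)^-1 / 2 = (24 * L)^-1 by field.
  by have -> : (2 * (12 * L)^-1)^-1 = 6 * L by field.
have NL0 : 0 <= (N * L)^-1 by rewrite invr_ge0 mulr_ge0 ?ltW.
have iN0 : 0 <= N^-1 by rewrite invr_ge0 ltW.
have iN1 : N^-1 <= 1 by rewrite invf_le1.
have sS0 : 0 <= (N * L)^-1 * dot s s by rewrite mulr_ge0 ?dot_ge0.
have sw_lo : - ((N * L)^-1 * dot s s / 96 + 3 / 32 * (L / N * dot X X)) <=
    (16 * N * L)^-1 * dot s w.
  have := ler_wpM2l NL0 sw; have := ler_wpM2l NL0 WX.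
  have -> : (N * L)^-1 * (L ^+ 2 * dot X X) = L / N * dot X X.
    by field; rewrite Ln Nn.
  have -> : (16 * N * L)^-1 = (N * L)^-1 / 16 by field; rewrite Ln Nn.
  lra.
have U_lo : (N * L)^-1 * dot s s * N^-1 / 16 <= lyap_a2 L N * U.
  have := ler_wpM2l iN0 (ler_wpM2l NL0 SU).
  have -> : N^-1 * ((N * L)^-1 * (N * U)) = 16 * (lyap_a2 L N * U).
    by rewrite /lyap_a2; field; rewrite Ln Nn.
  lra.
have sX_lo : - ((N * L)^-1 * dot s s / 48 + 3 * (L / N * dot X X)) <=
    2 * lyap_b N * dot s X.
  rewrite lerNl -mulNr.
  have b0 : 0 <= - (2 * lyap_b N).
    have -> : - (2 * lyap_b N) = N^-1 / 2 * (1 - N^-1).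
      by rewrite /lyap_b; field.
    by rewrite mulr_ge0 ?divr_ge0// subr_ge0.
  apply: (le_trans (ler_wpM2l b0 sX)).
  set P := _ + _.
  have P0 : 0 <= P.
    by rewrite addr_ge0 ?mulr_ge0 ?dot_ge0 ?invr_ge0 ?mulr_ge0 ?ltW.
  have : - (2 * lyap_b N) <= N^-1 / 2.
    have -> : - (2 * lyap_b N) = N^-1 / 2 * (1 - N^-1).
      by rewrite /lyap_b; field.
    by rewrite ler_piMr ?divr_ge0// gerBl.
  move=> /(ler_wpM2r P0) /le_trans; apply; rewrite le_eqVlt; apply/orP/or_introl.
  by apply/eqP; rewrite /P; field; rewrite Ln Nn.
have a1E : lyap_a1 L N * dot s s =
    (N * L)^-1 * dot s s / 32 * (1 - N^-1 + N^-1 ^+ 2 / 2).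
  by rewrite /lyap_a1; field; rewrite Ln Nn.
have cE : lyap_c L N * dot X X = 4 * (L / N * dot X X).
  by rewrite /lyap_c; ring.
have X0 : 0 <= L / N * dot X X by rewrite mulr_ge0 ?dot_ge0 ?divr_ge0 ?ltW.
have s1 : 0 <= (N * L)^-1 * dot s s * N^-1 by rewrite mulr_ge0.
have s2 : 0 <= (N * L)^-1 * dot s s * N^-1 ^+ 2 by rewrite mulr_ge0 ?sqr_ge0.
move: gz sw_lo U_lo sX_lo sS0 X0 s1 s2; rewrite a1E cE -/g; lra.
Qed.

Lemma lyapunov_init_zero x y :
  (forall i, y i = 0) -> lyapunov (x, y) = C0_zero f L x xs.
Proof.
move=> y0; rewrite /lyapunov /C0_zero /= -/N.
have -> : \sum_i y i = 0 by rewrite big1.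
rewrite scaler0 addr0 !dot0l !mulr0 !enorm_sqr.
under eq_bigr => i _ do rewrite y0 sub0r dotNl dotNr opprK -enorm_sqr.
by rewrite /lyap_a2 /lyap_c; field; rewrite Ln Nn.
Qed.

(** The sum of squares is now a variance, at most the sum of
    [|f_i'(x) - f_i'(x_star)|^2], which [cocoercive] bounds by [2 L N] times the
    gap; its weight [a2] turns this into an eighth of the gap. *)
Lemma lyapunov_init_centered x y :
  (forall i, y i = grad (f i) x - grad g x) ->
  lyapunov (x, y) <= C0_centered f L x xs.
Proof.
move=> yE; rewrite /lyapunov /C0_centered /= -/N enorm_sqr.
have -> : \sum_i y i = 0.
  under eq_bigr => i _ do rewrite yE.
  rewrite sumrB sumr_const card_ord /g grad_average// -scaler_nat scalerA.
  by rewrite divff// scale1r subrr.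
rewrite scaler0 addr0 !dot0l !mulr0 !addr0 -/g.
set U := \sum_i _.
set v := fun i => grad (f i) x - grad (f i) xs.
have gxs0 := grad_average_min n_gt0 f_diff L_gt0 f_smooth xs_min.
rewrite -/g in gxs0.
have UV : U <= \sum_i dot (v i) (v i).
  have -> : U = \sum_i (dot (v i) (v i) + dot (grad g x) (grad g x)
      - 2 * dot (v i) (grad g x)).
    apply: eq_bigr => i _.
    have -> : y i - grad (f i) xs = v i - grad g x.
      by rewrite yE /v addrAC.
    by rewrite dot_sqrB (dotC (grad g x)).
  have vs : \sum_i v i = N *: grad g x by exact: grad_average_sub.
  have vw : \sum_i dot (v i) (grad g x) = N * dot (grad g x) (grad g x).
    by rewrite -dot_suml vs dotZl.
  rewrite !big_split/= sumrN -mulr_sumr vw.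
  rewrite sumr_const card_ord -mulr_natl -/N.
  by have := mulr_ge0 (ltW N_gt0) (dot_ge0 (grad g x)); lra.
have VG : \sum_i dot (v i) (v i) <= 2 * L * (N * (g x - g xs)).
  have -> : N * (g x - g xs) = \sum_i (f i x - f i xs - dot (grad (f i) xs) (x - xs)).
    rewrite !sumrB -dot_suml sum_grad_min dot0l subr0 /g /average.
    by rewrite mulrBr !mulVKf.
  rewrite mulr_sumr; apply: ler_sum => i _.
  have := cocoercive xs x (f_convex i) (f_diff i) (@f_smooth i) L_gt0.
  rewrite -lerBrDl ler_pdivrMl ?mulr_gt0// opprD addrA; exact.
have a20 : 0 <= lyap_a2 L N by rewrite invr_ge0 !mulr_ge0 ?ltW.
have := ler_wpM2l a20 (le_trans UV VG).
have -> : lyap_a2 L N * (2 * L * (N * (g x - g xs))) = (g x - g xs) / 8.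
  by rewrite /lyap_a2; field; rewrite Ln Nn.
by have := xs_min x; rewrite -/g /lyap_c; lra.
Qed.

(** Sum the tangent inequalities at the mean point: their linear parts
    cancel. *)
Lemma average_jensen k (z : 'I_k -> 'rV[R]_p) (c : R) : (0 < k)%N ->
  g (k%:R^-1 *: \sum_j z j) - c <= k%:R^-1 * \sum_j (g (z j) - c).
Proof.
move=> k0; have K0 : 0 < k%:R :> R by rewrite ltr0n.
set m := _ *: _; rewrite ler_pdivlMl// mulr_natl -[X in _ *+ X]card_ord.
rewrite -sumr_const -subr_ge0 -sumrB.
apply: (@le_trans _ _ (\sum_j dot (grad g m) (z j - m))).
  rewrite (_ : \sum_j _ = dot (grad g m) (\sum_j (z j - m))); last first.
    by rewrite dotC dot_suml; apply: eq_bigr => j _; rewrite dotC.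
  rewrite sumrB sumr_const card_ord -scaler_nat scalerA divff ?gt_eqF//.
  by rewrite scale1r subrr dot0r.
by apply: ler_sum => j _; have := average_grad_le m (z j); lra.
Qed.

(** * Convergence rates *)

Section Rates.
Variables (x0 : 'rV[R]_p) (y0 : 'I_n -> 'rV[R]_p).
Let run := sag_run f (1 / (16 * L)) x0 y0.

Let gap_ge0 x : 0 <= g x - g xs. Proof. by rewrite subr_ge0. Qed.

(** Adding to the potential the accumulated gaps, weighted by the guaranteed
    decrease [1 / (32 N)], gives a quantity whose mean does not increase. *)
Lemma sag_mean_rate k : (0 < k)%N ->
  draw_mean k (fun t => g (k%:R^-1 *: \sum_(j < k) (run (take j t)).1)) - g xs
    <= 32 * N / k%:R * lyapunov (x0, y0).
Proof.
move=> k0; have K0 : 0 < k%:R :> R by rewrite ltr0n.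
pose Phi t := lyapunov (run t) +
  (32 * N)^-1 * \sum_(j < size t) (g (run (take j t)).1 - g xs).
have Phi_step t : n%:R^-1 * \sum_i Phi (rcons t i) <= 1 * Phi t.
  have g_convex x' y' : g x' + dot (grad g x') (y' - x') +
      0 / 2 * dot (y' - x') (y' - x') <= g y'.
    by rewrite !mul0r addr0; exact: average_grad_le.
  have := lyapunov_decrease (tau := 0) (run t).1 (run t).2 g_convex.
  rewrite -surjective_pairing !mul0r => /(_ (lexx 0) _ (lexx 0)) decr.
  have {}decr := decr ltac:(lra).
  pose S := \sum_(j < size t) (g (run (take j t)).1 - g xs).
  have PhiE i : Phi (rcons t i) = lyapunov (sag_step f (1 / (16 * L)) (run t) i)
      + (32 * N)^-1 * (S + (g (run t).1 - g xs)).
    rewrite /Phi /run sag_run_rcons size_rcons big_ord_recr/=; congr (_ + _ * _).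
    rewrite -cats1 take_size_cat//; congr (_ + _).
    by apply: eq_bigr => j _; rewrite takel_cat// ltnW.
  under eq_bigr => i _ do rewrite PhiE.
  have sumC (c : R) : n%:R^-1 * \sum_(i < n) c = c.
    by rewrite sumr_const card_ord -(mulr_natl c) mulKf.
  rewrite big_split/= mulrDr sumC /Phi -/S.
  have -> : (32 * N)^-1 = N^-1 / 32 by field.
  by move: decr; rewrite -/N -/g; lra.
have c_ge0 : 0 <= 32 * N / k%:R by rewrite divr_ge0 ?mulr_ge0 ?ltW.
have := draw_mean_geometric n_gt0 ler01 Phi_step k.
rewrite expr1n mul1r {2}/Phi/= big_ord0 mulr0 addr0 /run /sag_run/= -/run.
move=> PhiK; apply: (@le_trans _ _ (32 * N / k%:R * draw_mean k Phi)); last first.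
  by rewrite ler_wpM2l.
have := draw_mean_affine n_gt0 k (32 * N / k%:R) (g xs) Phi => affine.
rewrite lerBlDl -affine; apply: ler_draw_mean => t st.
rewrite -lerBlDl; apply: (le_trans (average_jensen _ _ k0)).
rewrite /Phi st mulrDr -[leLHS]add0r; apply: lerD.
  apply: mulr_ge0 => //; rewrite [run t]surjective_pairing.
  exact: le_trans (gap_ge0 _) (lyapunov_ge _ _).
rewrite mulrA le_eqVlt; apply/orP/or_introl/eqP; congr (_ * _).
by field; rewrite Nn gt_eqF.
Qed.

Lemma sag_linear_rate (mu : R) k : 0 < mu -> strongly_convex mu g ->
  draw_mean k (fun t => g (run t).1) - g xs <=
    (1 - Num.min (mu / (16 * L)) (1 / (8 * N))) ^+ k * lyapunov (x0, y0).
Proof.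
move=> mu0 g_sc; set m := Num.min _ _.
have m_mu : m <= mu / (16 * L) by rewrite ge_min lexx.
have m_N : m <= 1 / (8 * N) by rewrite ge_min lexx orbT.
have m0 : 0 <= m by rewrite le_min !divr_ge0 ?mulr_ge0 ?ltW.
have Nm : N * m <= 1 / 8.
  by rewrite mulrC -ler_pdivlMr// -mulrA -invfM.
have m1 : m <= 1 by have : m <= N * m by [rewrite ler_peMl]; lra.
have Lyap_step t : n%:R^-1 * \sum_i lyapunov (run (rcons t i)) <=
    (1 - m) * lyapunov (run t).
  have g_grad x' y' := strongly_convex_grad y' g_sc
    (differentiable_average f_diff x').
  have := lyapunov_decrease (tau := N * m) (run t).1 (run t).2 g_grad.
  have -> : N * m / N = m by rewrite mulrAC divff// mul1r.
  rewrite -surjective_pairing => decr.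
  have {}decr := decr (mulr_ge0 (ltW N_gt0) m0) Nm m_mu.
  under eq_bigr => i _ do rewrite /run sag_run_rcons -/run.
  apply: (le_trans decr); rewrite gerBl mulr_ge0//.
    by rewrite invr_ge0 ltW.
  by rewrite mulr_ge0// divr_ge0// subr_ge0.
have rho0 : 0 <= 1 - m by rewrite subr_ge0.
have := draw_mean_geometric n_gt0 rho0 Lyap_step k.
rewrite {2}/run /sag_run/= -/run; apply: le_trans.
have := draw_mean_affine n_gt0 k 1 (g xs) (fun t => lyapunov (run t)).
rewrite mul1r lerBlDl => <-; apply: ler_draw_mean => t _.
by rewrite mul1r -lerBlDl [run t]surjective_pairing; exact: lyapunov_ge.
Qed.

End Rates.

End Lyapunov.

Theorem theorem1 (R : realType) (n p : nat) (n_ge1 : (1 <= n)%N)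
    (p_ge1 : (1 <= p)%N)
    (f : 'I_n -> 'rV[R]_p -> R) (L : R) (L_gt0 : 0 < L)
    (f_convex : forall i, convex (f i))
    (f_diff : forall i (x : 'rV[R]_p), differentiable (f i) x)
    (f_smooth : forall i x y,
      enorm (grad (f i) x - grad (f i) y) <= L * enorm (x - y))
    (xstar : 'rV[R]_p)
    (xstar_min : forall x, average f xstar <= average f x)
    (d : measure_display) (T : measurableType d) (P : probability T R)
    (idx : nat -> T -> 'I_n) (idx_iid : uniform_iid P idx)
    (x0 : 'rV[R]_p) (y0 : 'I_n -> 'rV[R]_p) (C0 : R)
    (init :
      ((forall i, y0 i = 0) /\ C0 = C0_zero f L x0 xstar) \/
      ((forall i, y0 i = grad (f i) x0 - grad (average f) x0) /\
       C0 = C0_centered f L x0 xstar)) :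
  let g := average f in
  let alpha := 1 / (16 * L) in
  let x := fun k w => sag f alpha x0 y0 (idx ^~ w) k in
  let xbar := fun k w => sag_mean f alpha x0 y0 (idx ^~ w) k in
  (forall k, (1 <= k)%N ->
    ('E_P[fun w => g (xbar k w)] - (g xstar)%:E
      <= (32 * n%:R / k%:R * C0)%:E)%E) /\
  (forall mu : R, 0 < mu -> strongly_convex mu g ->
    forall k, (1 <= k)%N ->
    ('E_P[fun w => g (x k w)] - (g xstar)%:E
      <= ((1 - Num.min (mu / (16 * L)) (1 / (8 * n%:R))) ^+ k * C0)%:E)%E).
Proof.
move=> g alpha x xbar.
have smooth i y z := dot_le_of_enorm_le (ltW L_gt0) (f_smooth i y z).
have lyap0 : lyapunov f L xstar (x0, y0) <= C0.
  case: init => -[yE ->]; first by rewrite lyapunov_init_zero.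
  exact: lyapunov_init_centered.
split=> [k k1|mu mu0 g_sc k k1].
- pose gbar t := g (k%:R^-1 *:
    \sum_(j < k) (sag_run f alpha x0 y0 (take j t)).1).
  have -> : (fun w => g (xbar k w)) = (fun w => gbar (mkseq (idx ^~ w) k)).
    by apply/funext => w; rewrite /xbar sag_mean_run.
  rewrite (expectation_draws n_ge1 k gbar idx_iid) -EFinB lee_fin.
  apply: (le_trans (sag_mean_rate n_ge1 L_gt0 f_convex f_diff smooth xstar_min
    x0 y0 k1)).
  by rewrite ler_wpM2l// divr_ge0// mulr_ge0.
- pose gk t := g (sag_run f alpha x0 y0 t).1.
  have -> : (fun w => g (x k w)) = (fun w => gk (mkseq (idx ^~ w) k)).
    by apply/funext => w; rewrite /x /sag sag_state_run.
  rewrite (expectation_draws n_ge1 k gk idx_iid) -EFinB lee_fin.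
  apply: (le_trans (sag_linear_rate n_ge1 L_gt0 f_convex f_diff smooth
    xstar_min x0 y0 k mu0 g_sc)).
  rewrite ler_wpM2l// exprn_ge0// subr_ge0 ge_min; apply/orP; right.
  rewrite ler_pdivrMr ?mul1r ?mulr_gt0 ?ltr0n//.
  by rewrite -natrM ler1n muln_gt0.
Qed.
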